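(* Let $\mathbf z_1,\dots,\mathbf z_n$ be i.i.d. observations, let $\boldsymbol\theta_1,\dots,\boldsymbol\theta_p\in\mathbb R^q$ be parameters of their distribution ($q$ fixed, $p$ allowed to grow with $n$), and let $G^o, G^{no}\subseteq\{1,\dots,p\}$ be the given subsets. Put $G^o_1=\{j\in G^o:\boldsymbol\theta_j\ne\mathbf 0\}$, $G^o_0=\{j\in G^o:\boldsymbol\theta_j=\mathbf 0\}$, $G^{no}_1=\{j\in G^{no}:\boldsymbol\theta_j\neq\mathbf 0\}$, $G_1=G^o_1\cup G^{no}_1$. Suppose: (a) for each $j$, $\sqrt n(\hat{\boldsymbol\theta}_j-\boldsymbol\theta_j)\xrightarrow{d}N(\mathbf 0,\Sigma_j)$, where $\Sigma_j$ is consistently estimated by $\hat\Sigma_j$; (b) if $G^o_1\ne\emptyset$, then $\max_{j\in G^o_1}\|\hat{\boldsymbol\theta}_j\|\gg\max_{j\in G^o_0}\|\hat{\boldsymbol\theta}_j\|$; (c) there is a constant $c>0$ with $\lim_{n\to\infty}\inf_{j\in G_1}\|\sqrt n\,\Sigma_j^{-1/2}\boldsymbol\theta_j\|>c$. Fix the number of splits $L\ge1$ and $\alpha\in(0,1)$. Then the multi-split test ToMax$(L)$ (defined in the context) of $H_{0,G^o}:\boldsymbol\theta_j=\mathbf 0$ for all $j\in G^o$ asymptotically satisfies $$P\big(\text{ToMax}(L)\text{ rejects }H_{0,G^o}\,\big|\,H_{0,G^o}\text{ is true}\big)\le\alpha,$$ i.e. the $\limsup$ as $n\to\infty$ of the rejection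 probability under $H_{0,G^o}$ is at most $\alpha$.
   Context: Setting. $\mathbf z_1,\dots,\mathbf z_n$ are i.i.d. in $\mathbb R^d$ ($d$ may exceed $n$), $n$ even, $\bar n=n/2$. $G^o$ and $G^{no}$ are non-random index sets; their sizes may grow as fast as $p$, and $p$ may grow exponentially in $n$. $\|\cdot\|$ is the Euclidean norm. $\hat{\boldsymbol\theta}_j$ and $\hat\Sigma_j$ denote an estimator of $\boldsymbol\theta_j$ and an estimator of its asymptotic covariance $\Sigma_j$, both functions of the sample. For (possibly random) sequences, $a_n\gg b_n$ means that $a_n$ dominates $b_n$ in order, i.e. $b_n/a_n\to0$ (in probability); a comparison involving a maximum over an empty set is vacuous. Single-split ToMax $p$-value. Randomly split the sample into two disjoint halves $\mathcal D_1,\mathcal D_2$ of size $\bar n$ each. For $k=1,2$ let $\hat{\boldsymbol\theta}^{(k)}_j$ and $\widehat\Sigma_{kj}$ be the estimators of $\boldsymbol\theta_j$ and $\Sigma_j$ computed from $\mathcal D_k$. Choose $j_{\max}\in G^o$ maximizing $\|\widehat\Sigma_{1j}^{-1/2}\hat{\boldsymbol\theta}^{(1)}_{j}\|$ over $j\in G^o$; set $\widehat T_{\max}=\bar n\,\hat{\boldsymbol\theta}^{(2)\top}_{j_{\max}}\widehat\Sigma_{2j_{\max}}^{-1}\hat{\boldsymbol\theta}^{(2)}_{j_{\max}}$ and let the $p$-value be $\hat p_{\max}=1-F_{\chi^2(q)}(\widehat T_{\max})$, where $F_{\chi^2(q)}$ is the $\chi^2(q)$ distribution function. ToMax$(L)$.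 Repeat the random splitting $L$ times on the same data, obtaining $p$-values $\hat p_{1,\max},\dots,\hat p_{L,\max}$. Apply the Bonferroni–Holm adjustment to these $L$ $p$-values, and let $k_{\max}$ be the number of adjusted $p$-values less than $\alpha$. Reject $H_{0,G^o}$ if $k_{\max}\ge1$ (equivalently, if $\min_{1\le l\le L}\hat p_{l,\max}<\alpha/L$).
   Formalization: For growing p, condition (a) is required along every index sequence j_n in {1,…,p_n} (uniformly in j), for estimators from samples of size n and of size n/2; with (a) only for each fixed j the claim fails. *)

(* Defs.v *)
From HB Require Import structures.
From mathcomp Require Import all_boot all_order all_algebra.
From mathcomp Require Import all_classical all_reals all_analysis.
Set Implicit Arguments.
Unset Strict Implicit.
Unset Printing Implicit Defensive.
Import Order.TTheory GRing.Theory Num.Theory.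
Import numFieldNormedType.Exports.
Local Open Scope classical_set_scope.
Local Open Scope ring_scope.

Section linear_algebra.
Context {R : realType} {q : nat}.

(* The library norm on matrices is the maximum norm. *)
Definition enorm (v : 'cV[R]_q) : R := Num.sqrt (\sum_i v i 0 ^+ 2).

Definition posdefmx (A : 'M[R]_q) : Prop :=
  A^T = A /\ forall v : 'cV[R]_q, v != 0 -> 0 < (v^T *m A *m v) 0 0.

(* A^(-1/2); it is 0 when A is not symmetric positive definite. *)
Definition invsqrtmx (A : 'M[R]_q) : 'M[R]_q :=
  xget 0 [set B | posdefmx B /\ B *m B = invmx A].

End linear_algebra.

Section gaussian.
Context {R : realType}.

Local Notation RT := (measurableTypeR R).

Definition tuple_cons n (x : RT * n.-tuple RT) : n.+1.-tuple RT :=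
  [tuple of x.1 :: x.2].

Lemma measurable_tuple_cons n : measurable_fun setT (@tuple_cons n).
Proof. exact: measurable_cons. Qed.

HB.instance Definition _ n := isMeasurableFun.Build _ _ _ _ (@tuple_cons n)
  (@measurable_tuple_cons n).

(* N(0, I_q): the q-fold product of the standard normal law. *)
Fixpoint std_normal (q : nat) : probability (q.-tuple RT) R :=
  match q with
  | 0 => \d_ ([tuple] : 0.-tuple RT)
  | q'.+1 => distribution (normal_prob 0 1 \x std_normal q')%E (@tuple_cons q')
  end.

Definition chi2_cdf (q : nat) (t : R) : R :=
  fine (std_normal q [set x | \sum_(i < q) (tnth x i : R) ^+ 2 <= t]).

End gaussian.

(* Row k of a triangular array lives on its own probability space. *)
Section convergence.
Context {R : realType} {disp : nat -> measure_display}
  {Omega : forall k, measurableType (disp k)}.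
Variable P : forall k, probability (Omega k) R.

Definition cvg_to_std_normal (q : nat) (X : forall k, Omega k -> 'cV[R]_q) :=
  forall f : 'cV[R]_q -> R, continuous f ->
    (exists M, forall v, `|f v| <= M) ->
  (fun k => \int[P k]_w (f (X k w))%:E)%E @ \oo -->
    (\int[std_normal q]_x (f (\col_i (tnth x i : R)))%:E)%E.

Definition cvg_to_zero_in_prob (X : forall k, Omega k -> R) :=
  forall eps : R, 0 < eps -> (fun k => P k [set w | eps < `|X k w|]) @ \oo --> 0%E.

End convergence.

Section sampling.
Context {R : realType} {disp dT : measure_display}
  {Omega : measurableType disp} {T : measurableType dT}.
Variable P : probability Omega R.

Definition iid (n : nat) (z : 'I_n -> Omega -> T) : Prop :=
  [/\ forall i, measurable_fun setT (z i),
      forall i i' A, measurable A -> P (z i @^-1` A) = P (z i' @^-1` A) &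
      forall A : 'I_n -> set T, (forall i, measurable (A i)) ->
        P [set w | forall i, A i (z i w)] =
        (\prod_(i < n) P (z i @^-1` A i))%E].

(* S l is the set of indices forming D_1 in the l-th split: uniform on the
   subsets of size n / 2, the L splits being mutually independent and jointly
   independent of the data. *)
Definition random_splits (n L : nat) (z : 'I_n -> Omega -> T)
    (S : 'I_L -> Omega -> {set 'I_n}) : Prop :=
  [/\ forall l s, measurable [set w | S l w = s],
      forall l s, P [set w | S l w = s] =
        (if #|s| == n./2 then ('C(n, n./2)%:R^-1)%:E else 0)%E &
      forall (A : 'I_n -> set T) (s : 'I_L -> {set 'I_n}),
        (forall i, measurable (A i)) ->
        P [set w | (forall i, A i (z i w)) /\ (forall l, S l w = s l)] =
        (P [set w | forall i, A i (z i w)]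
         * \prod_(l < L) P [set w | S l w = s l])%E].

(* Statistics take data sets of arbitrary size, represented as sequences. *)
Definition measurable_statistic (g : seq T -> R) : Prop :=
  forall m, measurable_fun setT (fun t : m.-tuple T => g t).

Definition measurable_selection (p : nat) (g : seq T -> 'I_p) : Prop :=
  forall m j, measurable [set t : m.-tuple T | g t = j].

End sampling.

Definition subsample (T : Type) (n : nat) (x : 'I_n -> T) (S : {set 'I_n}) :
  seq T := [seq x i | i <- enum S].

Definition first_obs (T : Type) (n : nat) (x : 'I_n -> T) (m : nat) : seq T :=
  subsample x [set i : 'I_n | (i < m)%N]%SET.

(* Bonferroni-Holm: the i-th smallest adjusted p-value is
   max_(k <= i) min(1, (L - k) p_(k)), the order statistics being indexed
   from 0. *)
Definition holm_adjust (R : realType) (ps : seq R) : seq R :=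
  let s := sort <=%R ps in
  mkseq (fun i => \big[Num.max/0]_(k < i.+1)
                    Num.min 1 ((size ps - k)%:R * nth 0 s k)) (size ps).

Section tomax.
Context {R : realType} {q p : nat} {T : Type}.
Variables (thetahat : 'I_p -> seq T -> 'cV[R]_q)
          (Sigmahat : 'I_p -> seq T -> 'M[R]_q)
          (Go : {set 'I_p}).

(* jmax is an arbitrary maximizer over Go: the breaking of ties is left open. *)
Definition is_selector (jmax : seq T -> 'I_p) : Prop :=
  forall D, jmax D \in Go /\ forall j, j \in Go ->
    enorm (invsqrtmx (Sigmahat j D) *m thetahat j D)
    <= enorm (invsqrtmx (Sigmahat (jmax D) D) *m thetahat (jmax D) D).

Variable jmax : seq T -> 'I_p.

Section data.
Context {n : nat}.
Variable x : 'I_n -> T.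

Definition tomax_stat (S : {set 'I_n}) : R :=
  let j := jmax (subsample x S) in
  let D2 := subsample x (~: S)%SET in
  (n./2)%:R *
    ((thetahat j D2)^T *m invmx (Sigmahat j D2) *m thetahat j D2) 0 0.

Definition tomax_pvalue (S : {set 'I_n}) : R := 1 - chi2_cdf q (tomax_stat S).

Definition tomax_kmax (L : nat) (S : 'I_L -> {set 'I_n}) (alpha : R) : nat :=
  count (fun a => a < alpha)
    (holm_adjust [seq tomax_pvalue (S l) | l <- enum 'I_L]).

Definition tomax_rejects (L : nat) (S : 'I_L -> {set 'I_n}) (alpha : R) : bool :=
  (1 <= tomax_kmax S alpha)%N.

End data.
End tomax.

Definition nonzero_idx (R : realType) (q p : nat) (theta : 'I_p -> 'cV[R]_q)
  (G : {set 'I_p}) : {set 'I_p} :=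
  [set j in G | theta j != 0]%SET.

Definition zero_idx (R : realType) (q p : nat) (theta : 'I_p -> 'cV[R]_q)
  (G : {set 'I_p}) : {set 'I_p} :=
  [set j in G | theta j == 0]%SET.

Section array.
Context {R : realType} {q : nat} {disp : nat -> measure_display}
  {Omega : forall k, measurableType (disp k)}.
Variables (P : forall k, probability (Omega k) R) (p : nat -> nat)
  (T : nat -> Type) (n : nat -> nat)
  (z : forall k, 'I_(n k) -> Omega k -> T k)
  (theta : forall k, 'I_(p k) -> 'cV[R]_q)
  (Sigma : forall k, 'I_(p k) -> 'M[R]_q)
  (thetahat : forall k, 'I_(p k) -> seq (T k) -> 'cV[R]_q)
  (Sigmahat : forall k, 'I_(p k) -> seq (T k) -> 'M[R]_q).

(* The index set 'I_(p k) varies with the row, so an index followed as k goes to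
   infinity is a sequence of indices. Since Sigma k (j k) varies too, weak
   convergence to N(0, Sigma_j) and consistency for Sigma_j are stated in
   standardized form; both forms agree when Sigma_j does not depend on k.
   m k is the number of observations the estimators are computed from. *)
Definition asymptotically_normal (m : nat -> nat) : Prop :=
  forall j : forall k, 'I_(p k),
    let D k w := first_obs (fun i => z i w) (m k) in
    let V k := invsqrtmx (Sigma (j k)) in
    cvg_to_std_normal P (fun k w =>
      V k *m (Num.sqrt (m k)%:R *: (thetahat (j k) (D k w) - theta (j k))))
    /\ cvg_to_zero_in_prob P (fun k w =>
      `| V k *m Sigmahat (j k) (D k w) *m V k - 1%:M |).

(* max over Go_1 >> max over Go_0, in the rows where Go_1 is not empty; where
   Go_0 is empty the event below is empty. *)
Definition signal_dominates (Go : forall k, {set 'I_(p k)}) : Prop :=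
  let maxnorm k (G : {set 'I_(p k)}) w :=
    \big[Num.max/0]_(j in G)
       enorm (thetahat j (subsample (fun i => z i w) [set: 'I_(n k)]%SET)) in
  forall eps delta : R, 0 < eps -> 0 < delta ->
    \forall k \near \oo, nonzero_idx (@theta k) (Go k) != finset.set0 ->
      (P k [set w | eps * maxnorm k (nonzero_idx (@theta k) (Go k)) w <
                    maxnorm k (zero_idx (@theta k) (Go k)) w]%R
       <= delta%:E)%E.

(* ereal_inf set0 = +oo. *)
Definition min_signal (Go Gno : forall k, {set 'I_(p k)}) (k : nat) : \bar R :=
  ereal_inf [set (enorm (Num.sqrt (n k)%:R *: (invsqrtmx (Sigma j) *m theta j)))%:E
    | j in [set j | j \in nonzero_idx (@theta k) (Go k)
                        :|: nonzero_idx (@theta k) (Gno k)]].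

End array.

(* Main.v *)
Require Import Defs.
From HB Require Import structures.
From mathcomp Require Import all_boot all_order all_algebra.
From mathcomp Require Import all_classical all_reals all_analysis.
From mathcomp Require Import measurable_realfun ring lra.
Set Implicit Arguments.
Unset Strict Implicit.
Unset Printing Implicit Defensive.
Import Order.TTheory GRing.Theory Num.Theory.
Import numFieldNormedType.Exports.
Local Open Scope classical_set_scope.
Local Open Scope ring_scope.

(* Under H_0 every index of Go has theta_j = 0. Conditionally on the splits, the
   two half-samples are independent, so for one split the rejection probability
   is a mixture over j of P(jmax D1 = j) P(T_j(D2) is large), hence at most the
   maximum over j in Go of P(T_j is large) for a fixed half-sample. Along a
   sequence of maximizers j_k, hypothesis (a) for half-samples gives, by
   Slutsky's argument and a squeeze by bounded continuous functions, that T_(j_k)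
   is asymptotically chi^2(q); as the chi^2(q) distribution function is
   continuous, the limit is at most alpha / L. Holm's procedure rejects exactly
   when some p-value is below alpha / L, and the union bound over the L splits
   yields alpha. *)

(** * Holm adjustment and quadratic forms *)

(** The adjusted values are running maxima, so one of them is below alpha iff the first one is; that
    one is L p_(0) truncated to [0, 1], and 0 < alpha < 1 makes the truncation harmless. *)
Lemma holm_rejectsE (R : realType) (ps : seq R) (alpha : R) : 0 < alpha < 1 ->
  (0 < count (fun a => (a < alpha)%R) (holm_adjust ps))%N =
  has (fun x => (size ps)%:R * x < alpha) ps.
Proof.
case/andP=> a0 a1; rewrite -has_count; apply/idP/idP.
- case/hasP=> a /mapP[i]; rewrite mem_iota /= add0n => ilt ->.
  have ps_gt0 : (0 < size ps)%N by exact: leq_ltn_trans ilt.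
  case/bigmax_ltP=> _ /(_ ord0 isT) /=; rewrite subn0 gt_min ltNge (ltW a1) /=.
  move=> head_lt; apply/hasP; exists (nth 0 (sort <=%R ps) 0) => //.
  by rewrite -(mem_sort <=%R) mem_nth // size_sort.
- case/hasP=> a aps alt; have ps_gt0 : (0 < size ps)%N by case: ps aps {alt}.
  apply/hasP; eexists; first by apply: map_f; rewrite mem_iota; exact: ps_gt0.
  apply/bigmax_ltP; split=> // -[[|//] ilt] _ /=; rewrite subn0 gt_min.
  apply/orP; right; apply: le_lt_trans alt; rewrite ler_wpM2l //.
  have as_ : a \in sort <=%R ps by rewrite mem_sort.
  rewrite -[leRHS](nth_index 0 as_).
  have srt : sorted <=%R (sort <=%R ps) by apply: sort_sorted; exact: le_total.
  apply: (sorted_leq_nth le_trans lexx 0 srt); rewrite ?inE ?index_mem //.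
  by rewrite size_sort.
Qed.

Lemma quad_formE (R : comNzRingType) (q : nat) (A : 'M[R]_q) (u v : 'cV[R]_q) :
  (u^T *m A *m v) 0 0 = \sum_i \sum_j u i 0 * A i j * v j 0.
Proof.
rewrite mxE exchange_big /=; apply: eq_bigr => j _; rewrite mxE big_distrl /=.
by apply: eq_bigr => i _; rewrite mxE.
Qed.

(** Since |y_i y_j| <= (y_i^2 + y_j^2) / 2, summing over both indices gives the factor q. *)
Lemma quad_form_le (R : realFieldType) (q : nat) (N : 'M[R]_q) (eps : R)
  (y : 'cV[R]_q) : (forall i j, `|N i j| <= eps) ->
  `|(y^T *m N *m y) 0 0| <= q%:R * eps * \sum_i y i 0 ^+ 2.
Proof.
move=> Neps; rewrite quad_formE.
apply: (@le_trans _ _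
  (\sum_i \sum_j eps * ((y i 0 ^+ 2 + y j 0 ^+ 2) / 2))).
  apply: (le_trans (ler_norm_sum _ _ _)); apply: ler_sum => i _.
  apply: (le_trans (ler_norm_sum _ _ _)); apply: ler_sum => j _.
  rewrite !normrM mulrAC mulrC; apply: ler_pM => //.
  rewrite -(real_normK (num_real (y i 0))) -(real_normK (num_real (y j 0))).
  have := sqr_ge0 (`|y i 0| - `|y j 0|); nra.
rewrite le_eqVlt; apply/orP; left; apply/eqP.
set S := \sum_i _ ^+ 2.
transitivity (\sum_(i < q) eps * ((q%:R * y i 0 ^+ 2 + S) / 2)).
  apply: eq_bigr => i _; rewrite -mulr_sumr -mulr_suml big_split /=.
  by rewrite sumr_const card_ord mulr_natl.
rewrite -mulr_sumr -mulr_suml big_split /= -mulr_sumr -/S sumr_const card_ord.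
by rewrite -(mulr_natl S); field.
Qed.

(** * Matrices close to the identity *)

Section near_identity.
Context {R : realFieldType} {q : nat}.
Variables (M : 'M[R]_q) (eps : R).
Hypothesis M1 : forall i j, `|(M - 1%:M) i j| <= eps.
(** By [quad_form_le], a |y|^2 bounds the quadratic form of M - 1. *)
Let a := q%:R * eps.

(** With N = M - 1, |M y|^2 = |y|^2 + 2 y^T N y + |N y|^2; the last term is dropped. *)
Lemma sqnorm_near_id (y : 'cV[R]_q) :
  (1 - 2 * a) * \sum_i y i 0 ^+ 2 <= \sum_i (M *m y) i 0 ^+ 2.
Proof.
have My : M *m y = y + (M - 1%:M) *m y by rewrite mulmxBl mul1mx addrC subrK.
have := quad_form_le y M1; rewrite -/a; move: My; set N := M - 1%:M => My.
have Ny0 : 0 <= \sum_i (N *m y) i 0 ^+ 2 by apply: sumr_ge0 => i _; exact: sqr_ge0.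
have -> : \sum_i (M *m y) i 0 ^+ 2 = \sum_i y i 0 ^+ 2 +
    2 * (y^T *m N *m y) 0 0 + \sum_i (N *m y) i 0 ^+ 2.
  rewrite -mulmxA mxE mulr_sumr -!big_split /=; apply: eq_bigr => i _.
  by rewrite My !mxE; ring.
by rewrite ler_norml => /andP[]; lra.
Qed.

(** By [sqnorm_near_id] the kernel of M is trivial once 1 - 2 a > 0. The transpose enters because
    [det0P] produces a row vector. *)
Lemma near_id_unitmx : 2 * a < 1 -> M \in unitmx.
Proof.
move=> a1; rewrite -unitmx_tr unitmxE unitfE; apply/det0P => -[v v0 vM].
have Mv : M *m v^T = 0 by rewrite -[M]trmxK -trmx_mul vM trmx0.
have := sqnorm_near_id v^T; rewrite Mv [leRHS]big1 => [|i _]; last first.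
  by rewrite mxE expr0n.
rewrite pmulr_rle0 ?subr_gt0 // => sv0; case/eqP: v0; apply/rowP => i.
have : \sum_i (v^T) i 0 ^+ 2 == 0.
  by rewrite eq_le sv0 sumr_ge0 // => j _; exact: sqr_ge0.
rewrite psumr_eq0 => [/allP/(_ i)|j _]; last exact: sqr_ge0.
by rewrite mem_index_enum sqrf_eq0 !mxE => /(_ isT)/eqP.
Qed.

(** Put x = M y: the form equals y^T M y <= (1 + a) |y|^2, while (1 - 2 a) |y|^2 <= |x|^2. *)
Lemma quad_form_near_id (x : 'cV[R]_q) : 0 <= a -> 2 * a < 1 ->
  (1 - 2 * a) * (x^T *m invmx M *m x) 0 0 <= (1 + a) * \sum_i x i 0 ^+ 2.
Proof.
move=> a0 a1; have Mu := near_id_unitmx a1.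
have [y ->] : exists y, x = M *m y by exists (invmx M *m x); rewrite mulKVmx.
have := sqnorm_near_id y; have := quad_form_le y M1; rewrite -/a.
have y0 : 0 <= \sum_i y i 0 ^+ 2 by apply: sumr_ge0 => i _; exact: sqr_ge0.
rewrite -(mulmxA (M *m y)^T) mulKmx //.
have -> : ((M *m y)^T *m y) 0 0 =
    \sum_i y i 0 ^+ 2 + (y^T *m (M - 1%:M) *m y) 0 0.
  rewrite -mulmxA !mxE -big_split /=; apply: eq_bigr => i _.
  rewrite [in LHS]mxE -{1}(subrK 1%:M M) mulmxDl mul1mx !mxE; ring.
rewrite ler_norml => /andP[_ h1] h2.
by nra.
Qed.

End near_identity.

(** Standardizing the estimator to V t and the covariance to V S V leaves the studentized form
    unchanged; this links the test statistic to the quantities of hypothesis (a). Invertibility of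
    the product yields that of V and S. *)
Lemma quad_form_sandwich (R : fieldType) (q : nat) (V S : 'M[R]_q)
  (t : 'cV[R]_q) : V^T = V -> V *m S *m V \in unitmx ->
  ((V *m t)^T *m invmx (V *m S *m V) *m (V *m t)) = t^T *m invmx S *m t.
Proof.
move=> Vsym; rewrite !unitmx_mul => /andP[/andP[Vu Su] _].
have -> : invmx (V *m S *m V) = invmx V *m invmx S *m invmx V.
  have MU : V *m S *m V \in unitmx by rewrite !unitmx_mul Vu Su.
  apply: (can_inj (mulKmx MU)); rewrite mulmxV // -!mulmxA.
  by rewrite (mulKVmx Vu) (mulKVmx Su) mulmxV.
by rewrite trmx_mul Vsym -!mulmxA (mulKVmx Vu) (mulKmx Vu).
Qed.

Lemma invsqrtmx_sym (R : realType) (q : nat) (A : 'M[R]_q) :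
  (invsqrtmx A)^T = invsqrtmx A.
Proof.
by rewrite /invsqrtmx; case: xgetP => [B _ [[]]|_] //; rewrite trmx0.
Qed.

(** * Measurability of matrix operations *)

Lemma mx_norm_entry (R : realType) (m n : nat) (A : 'M[R]_(m, n)) i j :
  `|A i j| <= `|A|.
Proof.
rewrite [leRHS]mx_normrE.
exact: (le_bigmax 0 (fun k => `|A k.1 k.2|) (i, j)).
Qed.

Section measurable_matrix.
Context {d : measure_display} {T : measurableType d} {R : realType}.

Lemma measurable_pred_set (b : T -> bool) :
  measurable_fun setT b -> measurable [set x | b x].
Proof.
move=> mb; have := mb measurableT [set true] I; rewrite setTI.
by congr measurable; apply/seteqP; split.
Qed.

Lemma measurable_fun_inv (f : T -> R) :
  measurable_fun setT f -> measurable_fun setT (fun x => (f x)^-1).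
Proof.
move=> mf; rewrite (_ : (fun x => _) = (fun x => f x * (f x ^+ 2) `^ (-1))).
  apply: measurable_funM => //.
  apply: (@measurableT_comp _ _ _ _ _ _ (fun y : R => y `^ (-1))).
    exact: measurable_powR.
  exact: measurable_funX.
apply/funext => x; rewrite powR_inv1 ?sqr_ge0 //.
have [->|f0] := eqVneq (f x) 0; first by rewrite invr0 mul0r.
by rewrite expr2 invfM mulrA divff // mul1r.
Qed.

Lemma measurable_det (n : nat) (A : T -> 'M[R]_n) :
  (forall i j, measurable_fun setT (fun x => A x i j)) ->
  measurable_fun setT (fun x => \det (A x)).
Proof.
move=> mA; apply: measurable_sum => s; apply: measurable_funM => //.
by apply: measurable_prod => i _.
Qed.

Lemma measurable_invmx (n : nat) (A : T -> 'M[R]_n) :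
  (forall i j, measurable_fun setT (fun x => A x i j)) ->
  forall i j, measurable_fun setT (fun x => invmx (A x) i j).
Proof.
move=> mA i j; have mdet := measurable_det mA.
(* Adjugate formula; the first branch is there because [invmx] returns a singular matrix
   unchanged. *)
rewrite (_ : (fun x => _) = (fun x => if \det (A x) == 0 then A x i j
    else (\det (A x))^-1 * ((-1) ^+ (j + i) * \det (row' j (col' i (A x)))))).
  apply: measurable_fun_ifT => //; first exact: measurable_fun_eqr.
  apply: measurable_funM; first exact: measurable_fun_inv.
  apply: measurable_funM => //; apply: measurable_det => i' j'.
  by rewrite (_ : (fun x => _) = (fun x => A x (lift j i') (lift i j')))//;
    apply/funext => x; rewrite !mxE.
apply/funext => x; rewrite /invmx unitmxE unitfE.
by case: eqVneq => [//|_]; rewrite /= mxE; congr (_ * _); rewrite mxE.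
Qed.

Lemma measurable_mulmx (m n p : nat) (A : T -> 'M[R]_(m, n))
    (B : T -> 'M[R]_(n, p)) :
  (forall i j, measurable_fun setT (fun x => A x i j)) ->
  (forall i j, measurable_fun setT (fun x => B x i j)) ->
  forall i j, measurable_fun setT (fun x => (A x *m B x) i j).
Proof.
move=> mA mB i j; rewrite (_ : (fun x => _) =
    (fun x => \sum_k A x i k * B x k j)).
  by apply: measurable_sum => k; exact: measurable_funM.
by apply/funext => x; rewrite mxE.
Qed.

Lemma measurable_sqnorm (n : nat) (f : T -> 'cV[R]_n) :
  (forall i, measurable_fun setT (fun x => f x i 0)) ->
  measurable_fun setT (fun x => \sum_i f x i 0 ^+ 2).
Proof.
by move=> mf; apply: measurable_sum => i; exact: measurable_funX.
Qed.

Lemma measurable_mx_norm (m n : nat) (A : T -> 'M[R]_(m, n)) :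
  (forall i j, measurable_fun setT (fun x => A x i j)) ->
  measurable_fun setT (fun x => `|A x|).
Proof.
move=> mA; rewrite (_ : (fun x => _) =
    (fun x => \big[Num.max/0]_ij `|A x ij.1 ij.2|)); last first.
  by apply/funext => x; rewrite -mx_normrE.
elim: (index_enum _) => [|ij s ih].
  by under eq_fun do rewrite big_nil; exact: measurable_cst.
under eq_fun do rewrite big_cons; apply: measurable_maxr => //.
exact: measurableT_comp.
Qed.

End measurable_matrix.

(** * The chi-squared distribution *)

(** The product measure can also be computed by integrating the measures of the sections at a fixed
    second coordinate. *)
Lemma product_measure_null d1 d2 (T1 : measurableType d1)
    (T2 : measurableType d2) (R : realType) (P1 : probability T1 R)
    (P2 : probability T2 R) (A : set (T1 * T2)) :
  measurable A -> (forall y, P1 (ysection A y) = 0%E) -> (P1 \x P2)%E A = 0%E.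
Proof.
move=> mA A0; rewrite (@product_measure_unique _ _ _ _ _ _ _ (P1 \x^ P2)%E) //.
  by rewrite /product_measure2; apply: integral0_eq => y _ /=.
by move=> B C mB mC; exact: product_measure2E.
Qed.

(** The equation has at most two roots, a Lebesgue null set, and the normal law is absolutely
    continuous. *)
Lemma normal_prob_sqr_eq (R : realType) (c : R) :
  normal_prob 0 1 [set x | x ^+ 2 = c] = 0%E.
Proof.
pose t := [set Num.sqrt c; - Num.sqrt c].
have t0 : lebesgue_measure.-null_set t.
  apply/measure0_null_setP => //; first exact: measurableU.
  apply: countable_lebesgue_measure0; apply: finite_set_countable.
  by rewrite finite_setU; split; exact: finite_set1.
apply: (normal_prob_dominates _ _ t0).
  rewrite (_ : [set x | _] = [set x | x ^+ 2 == c]); last first.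
    by apply/seteqP; split => x /= /eqP.
  apply: (@measurable_pred_set _ R).
  by apply: measurable_fun_eqr => //; exact: measurable_funX.
move=> x /= xc; rewrite /t -xc sqrtr_sqr.
by case: (ler0P x) => _; [right; rewrite /= opprK|left].
Qed.

Section chi2.
Context {R : realType}.

(** Under [std_normal q] this is a chi-squared variable with q degrees of freedom. *)
Definition sqsum (q : nat) (x : q.-tuple (measurableTypeR R)) : R :=
  \sum_(i < q) (tnth x i : R) ^+ 2.

Lemma measurable_sqsum q : measurable_fun setT (@sqsum q).
Proof.
apply: measurable_sum => i; apply: measurable_funX.
exact: (@measurable_tnth _ (measurableTypeR R)).
Qed.

HB.instance Definition _ q := isMeasurableFun.Build _ _ _ _ (@sqsum q)
  (@measurable_sqsum q).

Lemma chi2_cdfE q (t : R) :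
  (chi2_cdf q t)%:E = cdf (@sqsum q : {RV std_normal q >-> R}) t.
Proof.
rewrite /chi2_cdf fineK; last first.
  apply: fin_num_measure; apply: measurable_pred_set.
  by apply: measurable_fun_ler => //; exact: measurable_sqsum.
by rewrite /cdf /distribution /pushforward; congr (std_normal q _).
Qed.

Lemma chi2_cdf_le q (s t : R) : s <= t -> chi2_cdf q s <= chi2_cdf q t.
Proof. by move=> st; rewrite -lee_fin !chi2_cdfE cdf_nondecreasing. Qed.

Lemma measurable_chi2_cdf q : measurable_fun setT (@chi2_cdf R q).
Proof.
by apply: nondecreasing_measurable => // s t; exact: chi2_cdf_le.
Qed.

Lemma measurable_sqsum_eq q (c : R) : measurable [set x | @sqsum q x = c].
Proof.
rewrite (_ : [set x | _] = [set x | sqsum x == c]); last first.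
  by apply/seteqP; split => x /= /eqP.
apply: (@measurable_pred_set _ (q.-tuple (measurableTypeR R))).
by apply: measurable_fun_eqr => //; exact: measurable_sqsum.
Qed.

Lemma sqsum_cons q (x : measurableTypeR R) (y : q.-tuple (measurableTypeR R)) :
  sqsum (tuple_cons (x, y)) = (x : R) ^+ 2 + sqsum y.
Proof.
rewrite /sqsum big_ord_recl; congr (_ + _).
by apply: eq_bigr => i _; rewrite !(tnth_nth x).
Qed.

(** Once the coordinates after the first are fixed, the first one must have a prescribed square, an
    event of probability 0. *)
Lemma sqsum_no_atom q (c : R) :
  std_normal q.+1 [set x | sqsum x = c] = 0%E.
Proof.
rewrite /= /distribution /pushforward; apply: product_measure_null.
  rewrite -[X in measurable X]setTI; apply: (@measurable_tuple_cons R q) => //.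
  exact: measurable_sqsum_eq.
move=> y; rewrite -[RHS](normal_prob_sqr_eq (c - sqsum y)).
congr (normal_prob _ _ _); apply/seteqP; split => x; rewrite /ysection /= inE /=.
  by rewrite sqsum_cons => <-; rewrite addrK.
by rewrite sqsum_cons => ->; rewrite subrK.
Qed.

(** Every distribution function is right continuous. Left continuity is right continuity for the
    opposite variable, whose distribution function is 1 - F(-s) because the law has no atoms. *)
Lemma chi2_cdf_continuous q : (0 < q)%N -> continuous (@chi2_cdf R q).
Proof.
case: q => // q _ t; pose X : {RV std_normal q.+1 >-> R} := @sqsum q.+1.
pose Y : {RV std_normal q.+1 >-> R} := (\- X)%R.
have YE s : cdf Y s = (1 - chi2_cdf q.+1 (- s))%:E.
  rewrite EFinB chi2_cdfE -(cdf_ccdf_1 X (- s)) addeAC subee ?fin_num_measure //.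
  rewrite add0e /cdf /ccdf /distribution /pushforward.
  rewrite (_ : _ @^-1` _ = X @^-1` `]- s, +oo[ `|` [set x | sqsum x = - s]).
    apply: measureU0; last exact: sqsum_no_atom.
      exact: (@measurable_funPTI _ _ _ _ X).
    exact: measurable_sqsum_eq.
  apply/seteqP; split => x /=; rewrite !in_itv /= ?andbT lerNl le_eqVlt.
    by case/predU1P => [->|]; [right|left].
  by case => [->|->]; rewrite ?orbT ?eqxx.
apply/left_right_continuousP; split; last first.
  have := @cdf_right_continuous _ _ _ _ X t.
  rewrite -[cdf X t]chi2_cdfE => /fine_cvg; apply: cvg_trans.
  by apply: near_eq_cvg; apply: nearW => s.
apply/cvg_at_leftNP.
have := @cdf_right_continuous _ _ _ _ Y (- t).
rewrite YE opprK => /fine_cvg h.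
rewrite (_ : _ \o _ = (fun s => 1 - (fine \o cdf Y) s)); last first.
  by apply/funext => s; rewrite /comp YE opprB addrC subrK.
rewrite [X in _ --> X](_ : _ = 1 - (1 - chi2_cdf q.+1 t)); last first.
  by rewrite opprB addrC subrK.
by apply: cvgB => //; exact: cvg_cst.
Qed.

(** Intermediate value theorem: F(0) = 0, as the point 0 carries no mass, and F tends to 1. *)
Lemma chi2_cdf_surj q (v : R) : (0 < q)%N -> 0 < v < 1 ->
  exists2 t, 0 < t & chi2_cdf q t = v.
Proof.
move=> q0 /andP[v0 v1]; have cF := chi2_cdf_continuous q0.
have [N vN] : exists N : R, v < chi2_cdf q N.
  have := @cvg_cdfy1 _ _ _ _ (@sqsum q : {RV std_normal q >-> R}).
  move=> /fine_cvg /cvgr_gt /(_ v v1) h.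
  near (pinfty_nbhs R) => N; exists N.
  by rewrite -[chi2_cdf q N]/(fine (chi2_cdf q N)%:E) chi2_cdfE; near: N.
have F0 : chi2_cdf q 0 = 0 :> R.
  apply/eqP; rewrite -eqe chi2_cdfE /cdf /distribution /pushforward.
  case: q q0 {cF vN} => // q _; rewrite -[X in _ == X](sqsum_no_atom q 0).
  apply/eqP; congr (std_normal _ _); apply/seteqP; split => x /=; rewrite in_itv /=.
    by move=> x0; apply/eqP; rewrite eq_le x0 sumr_ge0 // => i _; exact: sqr_ge0.
  by move=> ->.
have N0 : 0 <= N.
  rewrite leNgt; apply/negP => /ltW/(chi2_cdf_le q); rewrite F0 leNgt.
  by rewrite (lt_trans v0 vN).
have [t tN tv] : exists2 t, t \in `[0, N] & chi2_cdf q t = v.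
  apply: IVT => //; first exact: continuous_subspaceT.
  by rewrite F0 ge_min le_max (ltW v0) (ltW vN) orbT.
exists t => //; rewrite lt_neqAle eq_sym (itvP tN) andbT.
by apply/eqP => t0; move: v0; rewrite -tv t0 F0 ltxx.
Unshelve. all: by end_near. Qed.

End chi2.

(** * Laws of tuples of independent variables *)

Lemma measurable_forall d (T : measurableType d) (I : finType)
    (F : I -> set T) :
  (forall i, measurable (F i)) -> measurable [set x | forall i, F i x].
Proof.
move=> mF; rewrite (_ : [set x | _] = \bigcap_(i in [set: I]) F i).
  by apply: fin_bigcap_measurable => // i _.
by apply/seteqP; split => x h i; [move=> _|]; exact: h.
Qed.

Section tuple_measures.
Context {d : measure_display} {T : measurableType d} {R : realType} {n : nat}.

Definition rect (A : 'I_n -> set T) : set (n.-tuple T) :=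
  [set t | forall i, A i (tnth t i)].

Let G : set (set (n.-tuple T)) :=
  [set B | exists2 A, forall i, measurable (A i) & B = rect A].

Lemma measurable_rect A : (forall i, measurable (A i)) -> measurable (rect A).
Proof.
move=> mA; apply: (@measurable_forall _ (n.-tuple T)) => i.
rewrite -[X in measurable X]setTI; exact: measurable_tnth.
Qed.

(** A map into tuples is measurable once its coordinates are; the preimage of a set under one
    coordinate is a rectangle whose other sides are full. *)
Lemma measurable_tuple_rect : measurable = <<s G >>.
Proof.
apply/seteqP; split; last first.
  apply: smallest_sub; first exact: sigma_algebra_measurable.
  by move=> _ [A mA ->]; exact: measurable_rect.
suff mid : measurable_fun setT (id : g_sigma_algebraType G -> n.-tuple T).
  by move=> E mE; have := mid measurableT E mE; rewrite setTI.
apply/measurable_fun_tnthP => i _ B mB; rewrite setTI.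
apply: sub_sigma_algebra; exists (fun j => if j == i then B else setT).
  by move=> j; case: eqP.
apply/seteqP; split => t /= h; last by have := h i; rewrite eqxx.
by move=> j; case: eqP => // ->.
Qed.

(** Rectangles are stable under intersection, generate the sigma-algebra and include the whole
    space, of finite mass. *)
Lemma tuple_measure_unique (mu nu : {measure set (n.-tuple T) -> \bar R}) :
  (mu setT < +oo)%E ->
  (forall A, (forall i, measurable (A i)) -> mu (rect A) = nu (rect A)) ->
  forall E, measurable E -> mu E = nu E.
Proof.
move=> muoo mu_nu E mE.
apply: (measure_unique G (fun=> setT)) => //.
- exact: measurable_tuple_rect.
- move=> _ _ [A mA ->] [B mB ->]; exists (fun i => A i `&` B i).
    by move=> i; exact: measurableI.
  apply/seteqP; split => t /=; first by case=> hA hB i; split.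
  by move=> h; split => i; case: (h i).
- move=> _; exists (fun=> setT) => //.
  by apply/seteqP; split.
- by rewrite bigcup_const //; exists 0%N.
- by move=> _ [A mA ->]; exact: mu_nu.
Qed.

End tuple_measures.

Section tuple_laws.
Context {dO d : measure_display} {Omega : measurableType dO}
  {T : measurableType d} {R : realType}.
Variable P : probability Omega R.

Lemma measurable_mktuple n (Y : 'I_n -> Omega -> T) :
  (forall i, measurable_fun setT (Y i)) ->
  measurable_fun setT (fun w => [tuple Y i w | i < n]).
Proof.
move=> mY; apply/measurable_fun_tnthP => i.
by rewrite (_ : _ \o _ = Y i) //; apply/funext => w /=; rewrite tnth_mktuple.
Qed.

(** Independence extends from rectangles to all measurable B since both sides are finite measures in
    B: the law of the tuple restricted to E, and its law scaled by P E. *)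
Lemma tuple_indep_event n (Y : 'I_n -> Omega -> T) (E : set Omega) :
  (forall i, measurable_fun setT (Y i)) -> measurable E ->
  (forall A, (forall i, measurable (A i)) ->
    P ([set w | forall i, A i (Y i w)] `&` E) =
    (P [set w | forall i, A i (Y i w)] * P E)%E) ->
  forall B, measurable B ->
    P ([set w | B [tuple Y i w | i < n]] `&` E) =
    (P [set w | B [tuple Y i w | i < n]] * P E)%E.
Proof.
move=> mY mE YE B mB; have mZ := measurable_mktuple mY.
pose pushf m := @measure_function_pushforward__canonical__measure_function_Measure
  _ _ _ _ R m _ mZ.
have PE_ge0 : 0 <= fine (P E) by rewrite fine_ge0.
pose mu : {measure set (n.-tuple T) -> \bar R} := pushf (mrestr P mE).
pose nu : {measure set (n.-tuple T) -> \bar R} := mscale (NngNum PE_ge0) (pushf P).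
have nuE C : nu C = (P [set w | C [tuple Y i w | i < n]] * P E)%E.
  rewrite -[LHS]/((fine (P E))%:E * P [set w | C [tuple Y i w | i < n]])%E.
  by rewrite fineK ?fin_num_measure // muleC.
rewrite -nuE; apply: (@tuple_measure_unique _ _ _ _ mu nu) => //.
  by rewrite /mu /= /pushforward /mrestr preimage_setT setTI ltey_eq fin_num_measure.
move=> A mA; rewrite nuE -[LHS]/(P (_ `&` E)).
rewrite (_ : [set w | rect _ _] = [set w | forall i, A i (Y i w)]).
  rewrite -YE //; congr (P (_ `&` E)).
  by apply/seteqP; split => w h i; have := h i; rewrite tnth_mktuple.
by apply/seteqP; split => w h i; have := h i; rewrite /= tnth_mktuple.
Qed.

Lemma tuple_law_eq n (Y Y' : 'I_n -> Omega -> T) :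
  (forall i, measurable_fun setT (Y i)) ->
  (forall i, measurable_fun setT (Y' i)) ->
  (forall A, (forall i, measurable (A i)) ->
    P [set w | forall i, A i (Y i w)] = P [set w | forall i, A i (Y' i w)]) ->
  forall B, measurable B ->
    P [set w | B [tuple Y i w | i < n]] = P [set w | B [tuple Y' i w | i < n]].
Proof.
move=> mY mY' YY' B mB.
pose pushf Y mY := @measure_function_pushforward__canonical__measure_function_Measure
  _ _ _ _ R P _ (@measurable_mktuple n Y mY).
apply: (@tuple_measure_unique _ _ _ _ (pushf Y mY) (pushf Y' mY')) => //.
  by rewrite /= /pushforward preimage_setT ltey_eq fin_num_measure.
move=> A mA.
have rectE (Z : 'I_n -> Omega -> T) : [set w | rect A [tuple Z i w | i < n]] =
    [set w | forall i, A i (Z i w)].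
  by apply/seteqP; split => w h i; have := h i; rewrite /= tnth_mktuple.
rewrite -[LHS]/(P [set w | rect A [tuple Y i w | i < n]]).
rewrite -[RHS]/(P [set w | rect A [tuple Y' i w | i < n]]) !rectE.
exact: YY'.
Qed.

(** * Subtuples of an i.i.d. sample *)

Section iid_sample.
Context {n : nat}.
Variables (z : 'I_n -> Omega -> T) (z_iid : iid P z).

(** Coordinates outside the range of e receive the full set, hence contribute a factor 1. *)
Lemma iid_reindex (I : finType) (e : I -> 'I_n) (A : I -> set T) :
  injective e -> (forall i, measurable (A i)) ->
  P [set w | forall i, A i (z (e i) w)] = (\prod_i P (z (e i) @^-1` A i))%E.
Proof.
move=> e_inj mA; have [_ _ zA] := z_iid.
pose A' j := if [pick i | e i == j] is Some i then A i else setT.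
have A'e i : A' (e i) = A i.
  by rewrite /A'; case: pickP => [i' /eqP/e_inj->|/(_ i)]; rewrite ?eqxx.
have mA' j : measurable (A' j) by rewrite /A'; case: pickP.
rewrite (_ : [set w | _] = [set w | forall j, A' j (z j w)]); last first.
  apply/seteqP; split => w h j; last by rewrite -A'e; exact: h.
  by rewrite /A'; case: pickP => // i /eqP <-; exact: h.
rewrite zA // (bigID [in codom e]) /= [X in (_ * X)%E]big1 ?mule1; last first.
  move=> j je; rewrite /A'; case: pickP => [i /eqP ij|_].
    by rewrite -ij codom_f in je.
  by rewrite preimage_setT probability_setT.
rewrite -big_uniq /=; last by rewrite map_inj_uniq ?enum_uniq.
by rewrite big_map big_enum; apply: eq_bigr => i _; rewrite A'e.
Qed.

Lemma iid_subtuple_law m (e e' : 'I_m -> 'I_n) (B : set (m.-tuple T)) :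
  injective e -> injective e' -> measurable B ->
  P [set w | B [tuple z (e i) w | i < m]] =
  P [set w | B [tuple z (e' i) w | i < m]].
Proof.
move=> e_inj e'_inj mB; have [mz zz _] := z_iid.
apply: (@tuple_law_eq m (fun i => z (e i)) (fun i => z (e' i))) => // A mA.
by rewrite !iid_reindex //; apply: eq_bigr => i _; exact: zz.
Qed.

(** [tuple_indep_event] is applied twice, once for each tuple, which reduces the claim to a pair of
    rectangles. *)
Lemma iid_subtuple_indep m m' (e : 'I_m -> 'I_n) (e' : 'I_m' -> 'I_n) B B' :
  injective e -> injective e' -> (forall i i', e i != e' i') ->
  measurable B -> measurable B' ->
  P ([set w | B [tuple z (e i) w | i < m]] `&`
     [set w | B' [tuple z (e' i) w | i < m']]) =
  (P [set w | B [tuple z (e i) w | i < m]] *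
   P [set w | B' [tuple z (e' i) w | i < m']])%E.
Proof.
move=> e_inj e'_inj ee' mB mB'; have [mz _ _] := z_iid.
apply: (@tuple_indep_event m (fun i => z (e i))) => //.
  rewrite -[X in measurable X]setTI.
  exact: (@measurable_mktuple m' (fun i => z (e' i))).
move=> A mA; rewrite setIC [RHS]muleC.
have mE : measurable [set w | forall i, A i (z (e i) w)].
  by apply: measurable_forall => i; rewrite -[X in measurable X]setTI; exact: mz.
apply: (@tuple_indep_event m' (fun i => z (e' i))) => // A' mA'.
(* A pair of rectangles is one rectangle over the disjoint union of the index sets, which e and e'
   together embed into ['I_n]. *)
pose f (i : 'I_m + 'I_m') := match i with inl i => e i | inr i => e' i end.
pose C (i : 'I_m + 'I_m') := match i with inl i => A i | inr i => A' i end.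
have f_inj : injective f.
  move=> [i|i] [j|j] /= ij; first by rewrite (e_inj _ _ ij).
  - by have := ee' i j; rewrite ij eqxx.
  - by have := ee' j i; rewrite ij eqxx.
  - by rewrite (e'_inj _ _ ij).
have := @iid_reindex _ f C f_inj; rewrite big_sumType /= -!iid_reindex //.
rewrite [RHS]muleC => <-; last by case.
congr (P _); apply/seteqP; split => w.
  by case=> h' h [i|i]; [exact: h|exact: h'].
by move=> h; split => i; [exact: (h (inr i))|exact: (h (inl i))].
Qed.

End iid_sample.
End tuple_laws.

(** * Random splits *)

Section finite_decomposition.
Context {d : measure_display} {T : measurableType d} {R : realType}.
Variable P : probability T R.

Lemma measure_finType_partition (I : finType) (f : T -> I) (E : set T) :
  (forall i, measurable [set x | f x = i]) -> measurable E ->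
  P E = (\sum_i P (E `&` [set x | f x = i]))%E.
Proof.
move=> mf mE.
have sumE : (\sum_(i \in [set: I]) P (E `&` [set x | f x = i]) =
    \sum_i P (E `&` [set x | f x = i]))%E.
  apply: fsbig_fwiden; rewrite ?index_enum_uniq //.
    by move=> i _; rewrite /= mem_index_enum.
  by move=> i [_ []].
rewrite -sumE -measure_fin_bigcup; last 3 first.
- exact: finite_finset.
- by move=> i j _ _ [x [[_ <-] [_ <-]]].
- by move=> i _; exact: measurableI.
congr (P _); apply/seteqP; split => [x Ex|x [i _ []//]].
by exists (f x).
Qed.

Lemma finType_mix_restr (I : Type) (f : T -> I) (c : I -> T -> bool) (i : I) :
  [set x | c (f x) x] `&` [set x | f x = i] =
  [set x | c i x] `&` [set x | f x = i].
Proof. by apply/seteqP; split => x /= [] + fx; rewrite fx. Qed.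

(** On each event f x = i the random index is frozen to i. This serves both for the selected index
    and for the random splits. *)
Lemma measure_finType_mix (I : finType) (f : T -> I) (c : I -> T -> bool) :
  (forall i, measurable [set x | f x = i]) ->
  (forall i, measurable_fun setT (c i)) ->
  P [set x | c (f x) x] =
    (\sum_i P ([set x | c i x] `&` [set x | f x = i]))%E.
Proof.
move=> mf mc; rewrite (measure_finType_partition mf).
  by apply: eq_bigr => i _; rewrite finType_mix_restr.
rewrite (_ : [set x | _] = \bigcup_(i in [set: I])
    ([set x | c (f x) x] `&` [set x | f x = i])).
  apply: fin_bigcup_measurable => [|i _]; first exact: finite_finset.
  rewrite finType_mix_restr; apply: measurableI => //.
  exact: measurable_pred_set.
by apply/seteqP; split => x; [move=> h; exists (f x)|case=> i _ []].
Qed.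

Lemma measure_has_le (I : Type) (b : I -> T -> bool) (s : seq I) :
  (forall i, measurable_fun setT (b i)) ->
  (P [set x | has (b ^~ x) s] <= \sum_(i <- s) P [set x | b i x])%E.
Proof.
move=> mb; have mhas r : measurable_fun setT (fun x => has (b ^~ x) r).
  by elim: r => [|i r ih] /=; [exact: measurable_cst|exact: measurable_or].
elim: s => [|i s ih].
  by rewrite big_nil [X in P X](_ : _ = set0) ?measure0 //; apply/seteqP; split.
rewrite big_cons; apply: le_trans (leeD2l _ ih).
rewrite (_ : [set x | _] = [set x | b i x] `|` [set x | has (b ^~ x) s]).
  by apply: measureU2; exact: measurable_pred_set.
by apply/seteqP; split => x /=; [move/orP|move=> ?; apply/orP].
Qed.

Lemma measurable_exists (I : finType) (b : I -> T -> bool) :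
  (forall i, measurable_fun setT (b i)) ->
  measurable_fun setT (fun x => [exists i, b i x]).
Proof.
move=> mb _; apply: (measurable_fun_bool true) => //; rewrite setTI.
rewrite (_ : _ @^-1` _ = \bigcup_(i in [set: I]) [set x | b i x]).
  by apply: fin_bigcup_measurable => // i _; exact: measurable_pred_set.
by apply/seteqP; split => x /=; [move=> /existsP[i bi]; exists i|
  case=> i _ bi; apply/existsP; exists i].
Qed.

End finite_decomposition.

(** Laws live on tuples while statistics take sequences. The enumeration e depends on s alone, so it
    serves every data set x. *)
Lemma subsample_tuple (n m : nat) (s : {set 'I_n}) : #|s| = m ->
  exists e : 'I_m -> 'I_n, [/\ injective e, forall i, e i \in s &
    forall (T : Type) (x : 'I_n -> T),
      subsample x s = [tuple x (e i) | i < m]].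
Proof.
move=> <-; exists enum_val; split; [exact: enum_val_inj|exact: enum_valP|].
move=> T x; rewrite /subsample /= (map_comp x enum_val); congr map.
have [s0|/set0Pn[x0 _]] := eqVneq s finset.set0.
  by apply/eqP; rewrite s0 enum_set0 eq_sym -size_eq0 size_map size_enum_ord cards0.
apply: (@eq_from_nth _ x0); first by rewrite size_map size_enum_ord -cardE.
move=> i; rewrite -cardE => ilt.
rewrite (nth_map (Ordinal ilt)) ?size_enum_ord // (enum_val_nth x0).
by rewrite nth_enum_ord.
Qed.

Section splits.
Context {dO d : measure_display} {Omega : measurableType dO}
  {T : measurableType d} {R : realType}.
Variable P : probability Omega R.
Context {n : nat}.
Variables (z : 'I_n -> Omega -> T) (z_iid : iid P z).

Lemma measurable_subsample d' (U : measurableType d') (s : {set 'I_n})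
    (g : seq T -> U) :
  (forall m, measurable_fun setT (fun t : m.-tuple T => g t)) ->
  measurable_fun setT (fun t : n.-tuple T => g (subsample (tnth t) s)).
Proof.
move=> mg; have [e [_ _ sE]] := subsample_tuple (erefl #|s|).
under eq_fun do rewrite sE.
apply: (measurableT_comp (mg _)).
by apply: measurable_mktuple => i; exact: measurable_tnth.
Qed.

Lemma subsample_law m (s s' : {set 'I_n}) (b : seq T -> bool) :
  #|s| = m -> #|s'| = m ->
  (forall m, measurable_fun setT (fun t : m.-tuple T => b t)) ->
  P [set w | b (subsample (z ^~ w) s)] = P [set w | b (subsample (z ^~ w) s')].
Proof.
move=> /subsample_tuple[e [e_inj _ sE]] /subsample_tuple[e' [e'_inj _ s'E]] mb.
rewrite [X in P X](_ : _ = [set w | b [tuple z (e i) w | i < m]]); last first.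
  by apply/seteqP; split => w /=; rewrite sE.
rewrite [X in _ = P X](_ : _ = [set w | b [tuple z (e' i) w | i < m]]); last first.
  by apply/seteqP; split => w /=; rewrite s'E.
exact: (iid_subtuple_law z_iid e_inj e'_inj (measurable_pred_set (mb m))).
Qed.

Lemma subsample_indep (s : {set 'I_n}) (b b' : seq T -> bool) :
  (forall m, measurable_fun setT (fun t : m.-tuple T => b t)) ->
  (forall m, measurable_fun setT (fun t : m.-tuple T => b' t)) ->
  P ([set w | b (subsample (z ^~ w) s)] `&`
     [set w | b' (subsample (z ^~ w) (~: s)%SET)]) =
  (P [set w | b (subsample (z ^~ w) s)] *
   P [set w | b' (subsample (z ^~ w) (~: s)%SET)])%E.
Proof.
move=> mb mb'; have [e [e_inj es sE]] := subsample_tuple (erefl #|s|).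
have [e' [e'_inj e's s'E]] := subsample_tuple (erefl #|(~: s)%SET|).
have bE : [set w | b (subsample (z ^~ w) s)] =
    [set w | b [tuple z (e i) w | i < #|s|]].
  by apply/seteqP; split => w /=; rewrite sE.
have b'E : [set w | b' (subsample (z ^~ w) (~: s)%SET)] =
    [set w | b' [tuple z (e' i) w | i < #|(~: s)%SET|]].
  by apply/seteqP; split => w /=; rewrite s'E.
rewrite bE b'E.
have ee' i i' : e i != e' i'.
  by apply/eqP => ee'; have := e's i'; rewrite inE -ee' es.
exact: (iid_subtuple_indep z_iid e_inj e'_inj ee'
  (measurable_pred_set (mb _)) (measurable_pred_set (mb' _))).
Qed.

Lemma subsample_mktuple (s : {set 'I_n}) (w : Omega) :
  subsample (tnth [tuple z i w | i < n]) s = subsample (z ^~ w) s.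
Proof. by apply: eq_map => i; rewrite tnth_mktuple. Qed.

Lemma measurable_sample : measurable_fun setT (fun w => [tuple z i w | i < n]).
Proof. by apply: measurable_mktuple; case: z_iid. Qed.

Lemma measurable_statistic_subsample d' (U : measurableType d') (s : {set 'I_n})
    (g : seq T -> U) :
  (forall m, measurable_fun setT (fun t : m.-tuple T => g t)) ->
  measurable_fun setT (fun w => g (subsample (z ^~ w) s)).
Proof.
move=> mg; under eq_fun do rewrite -subsample_mktuple.
exact: (measurableT_comp (measurable_subsample s mg) measurable_sample).
Qed.

(** * Selection on one half, test on the other *)

Section two_sample.
Context {p : nat}.
Variables (jmax : seq T -> 'I_p) (b : 'I_p -> seq T -> bool).
Hypothesis mjmax : measurable_selection jmax.
Hypothesis mb : forall j m, measurable_fun setT (fun t : m.-tuple T => b j t).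

(** With b j D meaning that index j is significant on D, this is rejection by the split whose
    selection half is s. *)
Let bad (s : {set 'I_n}) (x : 'I_n -> T) : bool :=
  b (jmax (subsample x s)) (subsample x (~: s)%SET).

Let mj j m : measurable_fun setT (fun t : m.-tuple T => jmax t == j).
Proof.
move=> _; apply: (measurable_fun_bool true) => //; rewrite setTI.
rewrite (_ : _ @^-1` _ = [set t : m.-tuple T | jmax t = j]).
  exact: mjmax.
by apply/seteqP; split => t /= /eqP.
Qed.

Let measurable_bad s : measurable_fun setT (fun t : n.-tuple T => bad s (tnth t)).
Proof.
rewrite (_ : (fun t => _) = (fun t : n.-tuple T => [exists j,
    (jmax (subsample (tnth t) s) == j) && b j (subsample (tnth t) (~: s)%SET)])).
  apply: measurable_exists => j; apply: measurable_and.
    exact: (measurable_subsample (g := fun D => jmax D == j) s (mj j)).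
  exact: (measurable_subsample (g := b j) (~: s)%SET (mb j)).
apply/funext => t; apply/idP/existsP => [h|[j /andP[/eqP <-]]//].
by exists (jmax (subsample (tnth t) s)); rewrite eqxx.
Qed.

(** By independence of the two halves the probability is the sum over j of P(J = j) times that of b
    j on the other half. The latter is at most beta, since only the size of the half matters, and
    the former sum to 1. *)
Lemma single_split_le (m : nat) (s s0 : {set 'I_n}) (beta : \bar R) :
  #|(~: s)%SET| = m -> #|s0| = m ->
  (forall D, P [set w | b (jmax D) (subsample (z ^~ w) s0)] <= beta)%E ->
  (P [set w | bad s (z ^~ w)] <= beta)%E.
Proof.
move=> sm s0m b_le.
pose J w := jmax (subsample (z ^~ w) s).
have JE j : [set w | J w = j] = [set w | jmax (subsample (z ^~ w) s) == j].
  by apply/seteqP; split => w /eqP.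
have mJ j : measurable [set w | J w = j].
  rewrite JE; apply: measurable_pred_set.
  exact: (measurable_statistic_subsample (g := fun D => jmax D == j) s (mj j)).
rewrite (measure_finType_mix P
  (c := fun j w => b j (subsample (z ^~ w) (~: s)%SET)) mJ); last first.
  by move=> j; exact: (measurable_statistic_subsample (g := b j) _ (mb j)).
apply: (@le_trans _ _ (\sum_j P (setT `&` [set w | J w = j]) * beta)%E).
  apply: lee_sum => j _; rewrite setTI setIC JE.
  rewrite (subsample_indep s (b := fun D => jmax D == j)) // -JE.
  (* [b_le] speaks of the indices that [jmax] attains; if no sample point selects j, the event J = j
     is empty. *)
  have [[w Jw]|Jj] := pselect (exists w, J w = j); last first.
    rewrite [X in P X](_ : _ = set0) ?measure0 ?mul0e //.
    by apply/seteqP; split => // w Jw; apply: Jj; exists w.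
  apply: lee_wpmul2l => //; rewrite (subsample_law sm s0m (mb j)).
  by rewrite -Jw; exact: b_le.
rewrite -ge0_sume_distrl //.
by rewrite -(measure_finType_partition P mJ measurableT) probability_setT mul1e.
Qed.

(** Given the values of the L splits the data keep their law, so the union bound over l and
    [single_split_le] apply; averaging over these values keeps the bound. *)
Lemma multi_split_le (L : nat) (S : 'I_L -> Omega -> {set 'I_n})
    (s0 : {set 'I_n}) (beta : R) :
  random_splits P z S -> #|s0| = (n - n./2)%N ->
  (forall D, P [set w | b (jmax D) (subsample (z ^~ w) s0)] <= beta%:E)%E ->
  (P [set w | has (fun l => bad (S l w) (z ^~ w)) (enum 'I_L)]
    <= (L%:R * beta)%:E)%E.
Proof.
case=> mS S_unif S_indep s0n b_le.
(* The splits are bundled into one variable with finitely many values, so that they can be frozen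
   jointly. *)
pose Sf w := [ffun l => S l w].
have SfE s : [set w | Sf w = s] = [set w | forall l, S l w = s l].
  apply/seteqP; split => w /= h; first by move=> l; rewrite -h ffunE.
  by apply/ffunP => l; rewrite ffunE.
have mSf s : measurable [set w | Sf w = s].
  by rewrite SfE; apply: measurable_forall => l; exact: mS.
have PSf s : P [set w | Sf w = s] = (\prod_l P [set w | S l w = s l])%E.
  have := S_indep (fun=> setT) s (fun=> measurableT).
  rewrite [X in (X * _)%E](_ : _ = 1%E) ?mul1e.
    move=> <-; rewrite SfE; congr (P _).
    by apply/seteqP; split => w /=; [split|case].
  by rewrite -[RHS](probability_setT P); congr (P _); apply/seteqP; split.
pose any (s : {ffun 'I_L -> {set 'I_n}}) x :=
  has (fun l => bad (s l) x) (enum 'I_L).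
have many s : measurable_fun setT (fun t : n.-tuple T => any s (tnth t)).
  rewrite /any; elim: (enum _) => [|l r ih] /=; first exact: measurable_cst.
  exact: measurable_or.
have badZ s w : bad s (tnth [tuple z i w | i < n]) = bad s (z ^~ w).
  by rewrite /bad !subsample_mktuple.
have anyZ s w : any s (tnth [tuple z i w | i < n]) = any s (z ^~ w).
  by apply: eq_has => l; rewrite badZ.
have manyZ s : measurable_fun setT (fun w => any s (z ^~ w)).
  under eq_fun do rewrite -anyZ.
  exact: (measurableT_comp (many s) measurable_sample).
have anyS w : any (Sf w) (z ^~ w) =
    has (fun l => bad (S l w) (z ^~ w)) (enum 'I_L).
  by apply: eq_has => l; rewrite ffunE.
rewrite (_ : [set w | _] = [set w | any (Sf w) (z ^~ w)]); last first.
  by apply/seteqP; split => w; rewrite /= anyS.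
rewrite (measure_finType_mix P (c := fun s w => any s (z ^~ w)) mSf manyZ).
(* [b_le], taken at the empty data set, puts a probability below beta. *)
have beta_ge0 : (0 <= (L%:R * beta)%:E)%E.
  have D : seq T := [::]; have := le_trans (measure_ge0 _ _) (b_le D).
  by rewrite !lee_fin => beta0; rewrite mulr_ge0.
apply: (@le_trans _ _
  (\sum_s (L%:R * beta)%:E * P (setT `&` [set w | Sf w = s]))%E).
  apply: lee_sum => s _; rewrite setTI.
  rewrite (_ : [set w | any s _] =
      [set w | [set t : n.-tuple T | any s (tnth t)] [tuple z i w | i < n]]);
    last first.
    by apply/seteqP; split => w /=; rewrite anyZ.
  have [mz _ _] := z_iid.
  rewrite (tuple_indep_event (E := [set w | Sf w = s])) //; last 2 first.
  - by move=> A mA; rewrite PSf SfE -S_indep.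
  - exact: measurable_pred_set.
  (* A family containing a set of the wrong size has probability 0. *)
  have [sn|] := pselect (forall l, #|s l| = n./2); last first.
    move=> /existsNP[l /eqP sl]; rewrite PSf (bigD1 l) //= S_unif (negbTE sl).
    by rewrite mul0e !mule0.
  apply: lee_wpmul2r => //.
  rewrite [X in P X](_ : _ =
    [set w | has (fun l => bad (s l) (z ^~ w)) (enum 'I_L)]); last first.
    by apply/seteqP; split => w /=; rewrite anyZ.
  apply: le_trans.
    apply: (measure_has_le P (b := fun l w => bad (s l) (z ^~ w))) => l.
    under eq_fun do rewrite -badZ.
    exact: (measurableT_comp (measurable_bad (s l)) measurable_sample).
  rewrite big_enum /= mulr_natl -[L in (_ *+ L)]card_ord -sumr_const -sumEFin.
  apply: lee_sum => l _; apply: (single_split_le _ s0n b_le).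
  by rewrite cardsCs finset.setCK card_ord sn.
rewrite -ge0_sume_distrr //.
by rewrite -(measure_finType_partition P mSf measurableT) probability_setT mule1.
Qed.

End two_sample.
End splits.

(** * Asymptotics *)

Lemma continuous_sqnorm (R : realType) (q : nat) :
  continuous (fun v : 'cV[R]_q => \sum_i v i 0 ^+ 2).
Proof.
elim: (index_enum _) => [|i s ih] v.
  rewrite (_ : (fun v => _) = cst 0); first exact: cst_continuous.
  by apply/funext => u; rewrite big_nil.
rewrite (_ : (fun v => _) = (fun v : 'cV[R]_q =>
    v i 0 * v i 0 + \sum_(i0 <- s) v i0 0 ^+ 2)).
  have c0 : {for v, continuous (fun v : 'cV[R]_q => v i 0)}.
    exact: coord_continuous.
  exact: (continuousD (continuousM c0 c0) (ih v)).
by apply/funext => u; rewrite big_cons expr2.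
Qed.

(** * Tail bounds from convergence in distribution *)

Section weak_limit.
Context {R : realType} {disp : nat -> measure_display}
  {Omega : forall k, measurableType (disp k)}.
Variable P : forall k, probability (Omega k) R.

(** A continuous ramp g, equal to 0 up to t and to 1 beyond u, gives P(|X|^2 > u) <= E g(|X|^2), and
    the limit of the right side is at most the chi-squared tail beyond t. *)
Lemma sqnorm_tail_near (q : nat) (X : forall k, Omega k -> 'cV[R]_q) (t u : R) :
  (forall k i, measurable_fun setT (fun w => X k w i 0)) ->
  cvg_to_std_normal P X -> t < u ->
  forall eta, 0 < eta -> \forall k \near \oo,
    (P k [set w | (u < \sum_i X k w i 0 ^+ 2)%R] <=
     (1 - chi2_cdf q t + eta)%:E)%E.
Proof.
move=> mX cX tu eta eta0.
pose g (r : R) := Num.min 1 (Num.max 0 ((r - t) / (u - t))).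
have ut0 : 0 < u - t by rewrite subr_gt0.
have g_ge0 r : 0 <= g r by rewrite /g le_min ler01 le_max lexx.
have g_le1 r : g r <= 1 by rewrite /g ge_min lexx.
have g_out r : r <= t -> g r = 0.
  move=> rt; rewrite /g; have : (r - t) / (u - t) <= 0.
    by rewrite pmulr_lle0 ?invr_gt0 // subr_le0.
  by move/max_idPl => ->; apply/min_idPr; exact: ler01.
have g_in r : u < r -> g r = 1.
  move=> ur; rewrite /g; have : 1 <= (r - t) / (u - t).
    by rewrite ler_pdivlMr // mul1r lerD2r ltW.
  by move=> h; apply/min_idPl; rewrite le_max h orbT.
have mg : measurable_fun setT g.
  apply: measurable_minr => //; apply: measurable_maxr => //.
  by apply: measurable_funM => //; exact: measurable_funB.
pose f (v : 'cV[R]_q) := g (\sum_i v i 0 ^+ 2).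
have cg : continuous g.
  move=> r; have cc (c : R) : {for r, continuous (fun=> c : R)}.
    exact: cst_continuous.
  have cid : {for r, continuous (id : R -> R)} by move=> A.
  have ca := continuousM (continuousB cid (cc t)) (cc (u - t)^-1).
  exact: (@continuous_min R R _ _ _ (cc 1) (@continuous_max R R _ _ _ (cc 0) ca)).
have cf : continuous f.
  by move=> v; exact: (continuous_comp (@continuous_sqnorm R q v) (cg _)).
have fb : exists M, forall v, `|f v| <= M.
  by exists 1 => v; rewrite ger0_norm ?g_ge0 ?g_le1.
have cint := cX f cf fb.
(* The slack eta makes the inequality strict, so that it passes from the limit to all large k. *)
have lim_lt : ((\int[std_normal q]_x (f (\col_i (tnth x i : R)))%:E)%E <
    (1 - chi2_cdf q t + eta)%:E)%E.
  apply: (@le_lt_trans _ _ (1 - chi2_cdf q t)%:E); last by rewrite lte_fin ltrDl.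
  pose W : {RV std_normal q >-> R} := @sqsum R q.
  have -> : (1 - chi2_cdf q t)%:E = ccdf W t.
    rewrite EFinB chi2_cdfE -(cdf_ccdf_1 W t) addeAC subee ?fin_num_measure //.
    by rewrite add0e.
  have mS : measurable (W @^-1` `]t, +oo[) by exact: measurable_funPTI.
  rewrite /ccdf /distribution /pushforward -(setIT (W @^-1` _)) -integral_indic //.
  apply: ge0_le_integral => //.
  - by move=> x _; rewrite lee_fin g_ge0.
  - apply/measurable_EFinP; apply: (measurableT_comp mg).
    under eq_fun do under eq_bigr do rewrite mxE.
    exact: measurable_sqsum.
  - by apply/measurable_EFinP; exact: measurable_indic.
  - move=> x _; rewrite lee_fin indicE /f.
    have -> : \sum_i (\col_i (tnth x i : R)) i 0 ^+ 2 = sqsum x.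
      by apply: eq_bigr => i _; rewrite mxE.
    case: (boolP (_ \in _)) => [_|]; first exact: g_le1.
    by rewrite notin_setE /= in_itv /= andbT => /negP; rewrite -leNgt => /g_out ->.
near=> k.
have : ((\int[P k]_w (f (X k w))%:E)%E < (1 - chi2_cdf q t + eta)%:E)%E.
  by near: k; exact: (cint _ (open_ereal_lt' lim_lt)).
move/ltW; apply: le_trans.
have mT : measurable_fun setT (fun w => \sum_i X k w i 0 ^+ 2).
  exact: measurable_sqnorm.
have mE : measurable [set w | (u < \sum_i X k w i 0 ^+ 2)%R].
  by apply: measurable_pred_set; exact: measurable_fun_ltr.
rewrite -[X in P k X]setIT -integral_indic //.
apply: ge0_le_integral => //.
- by apply/measurable_EFinP; exact: measurable_indic.
- by apply/measurable_EFinP; exact: (measurableT_comp mg).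
- move=> w _; rewrite lee_fin indicE /f.
  case: (boolP (_ \in _)) => [|_]; last exact: g_ge0.
  by rewrite inE => /g_in ->.
Unshelve. all: by end_near. Qed.

(** The limit superior is the infimum of the suprema over sets containing all large k; the set where
    the bound holds is one of them. *)
Lemma limn_esup_le_near (v : nat -> \bar R) (c : R) :
  (forall eta, 0 < eta -> \forall k \near \oo, (v k <= (c + eta)%:E)%E) ->
  (limn_esup v <= c%:E)%E.
Proof.
move=> vc; apply/lee_addgt0Pr => eta eta0.
apply: (@le_trans _ _ (ereal_sup (v @` [set k | (v k <= (c + eta)%:E)%E]))).
  by apply: ereal_inf_lbound; eexists; first exact: (vc eta eta0).
by apply: ge_ereal_sup => _ [k vk <-].
Qed.

End weak_limit.

(** * Slutsky's argument for the studentized statistic *)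

Section slutsky.
Context {R : realType} {disp : nat -> measure_display}
  {Omega : forall k, measurableType (disp k)}.
Variable P : forall k, probability (Omega k) R.

(** Let F(u) = v. If M is close to the identity, it is invertible and W > u forces |X|^2 > t' for a
    t' slightly below u. Hence the event is covered by M being far from the identity and by a tail
    event for |X|^2. *)
Lemma chi2_tail_near (q : nat) (X : forall k, Omega k -> 'cV[R]_q)
    (M : forall k, Omega k -> 'M[R]_q) (W : forall k, Omega k -> R) (v : R) :
  (0 < q)%N -> 0 < v < 1 ->
  (forall k i, measurable_fun setT (fun w => X k w i 0)) ->
  (forall k i j, measurable_fun setT (fun w => M k w i j)) ->
  (forall k, measurable_fun setT (W k)) ->
  (forall k w, M k w \in unitmx ->
    W k w = ((X k w)^T *m invmx (M k w) *m X k w) 0 0) ->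
  cvg_to_std_normal P X ->
  cvg_to_zero_in_prob P (fun k w => `|M k w - 1%:M|) ->
  forall eta, 0 < eta -> \forall k \near \oo,
    (P k [set w | (v < chi2_cdf q (W k w))%R] <= (1 - v + eta)%:E)%E.
Proof.
move=> q0 /andP[v0 v1] mX mM mW WE cX cM eta eta0.
have [u _ uv] : exists2 u, 0 < u & chi2_cdf q u = v.
  by apply: chi2_cdf_surj => //; rewrite v0.
(* The term v / 2 keeps v' positive, so that the quantile t exists; v - eta / 4 limits the loss in
   level to eta / 4. *)
pose v' := Num.max (v / 2) (v - eta / 4).
have v'v : v' < v by rewrite gt_max; apply/andP; split; lra.
have v'0 : 0 < v' by rewrite lt_max; apply/orP; left; lra.
have v'eta : v - eta / 4 <= v' by rewrite le_max lexx orbT.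
have [t t0 tv] : exists2 t, 0 < t & chi2_cdf q t = v'.
  by apply: chi2_cdf_surj => //; rewrite v'0 (lt_trans v'v).
have tu : t < u.
  by rewrite ltNge; apply/negP => /(chi2_cdf_le q); rewrite tv uv leNgt v'v.
(* The midpoint leaves room on both sides: t < t' for the weak limit, t' < u for the error in M. *)
pose t' := (t + u) / 2.
have tt' : t < t' by rewrite /t'; lra.
(* Chosen so that (1 + a) t' <= (1 - 2 a) u. *)
pose a := (u - t) / (8 * u).
have u0 : 0 < u by exact: lt_trans tu.
have aE : a * (8 * u) = u - t by rewrite /a divfK // mulf_neq0 ?gt_eqF.
have a0 : 0 < a by rewrite divr_gt0 ?subr_gt0 ?mulr_gt0.
have a1 : 2 * a < 1 by nra.
have at' : (1 + a) * t' <= (1 - 2 * a) * u by rewrite /t'; nra.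
have qR : 0 < q%:R :> R by rewrite ltr0n.
pose eps := a / q%:R.
have eps0 : 0 < eps by rewrite divr_gt0.
have qeps : q%:R * eps = a by rewrite /eps mulrC divfK // gt_eqF.
have eta4 : (0 < (eta / 4)%:E)%E by rewrite lte_fin divr_gt0.
have near_tail := sqnorm_tail_near mX cX tt' (divr_gt0 eta0 (ltr0n _ 4)).
near=> k.
have tail_le : (P k [set w | (t' < \sum_i X k w i 0 ^+ 2)%R] <=
    (1 - v' + eta / 4)%:E)%E.
  by rewrite -tv; near: k.
have M_le : (P k [set w | (eps < `| `|M k w - 1%:M| |)%R] < (eta / 4)%:E)%E.
  by near: k; exact: (cM eps eps0 _ (open_ereal_lt' eta4)).
have mE1 : measurable [set w | (v < chi2_cdf q (W k w))%R].
  apply: measurable_pred_set; apply: measurable_fun_ltr => //.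
  exact: (measurableT_comp (measurable_chi2_cdf q) (mW k)).
have mE2 : measurable [set w | (eps < `| `|M k w - 1%:M| |)%R].
  apply: measurable_pred_set; apply: measurable_fun_ltr => //.
  apply: measurableT_comp => //; apply: measurable_mx_norm => i j.
  rewrite (_ : (fun w => _) = (fun w => M k w i j - (1%:M : 'M[R]_q) i j)).
    exact: measurable_funB.
  by apply/funext => w; rewrite !mxE.
have mE3 : measurable [set w | (t' < \sum_i X k w i 0 ^+ 2)%R].
  by apply: measurable_pred_set; apply: measurable_fun_ltr => //;
    exact: measurable_sqnorm.
apply: (@le_trans _ _ (P k ([set w | (eps < `| `|M k w - 1%:M| |)%R] `|`
    [set w | (t' < \sum_i X k w i 0 ^+ 2)%R]))).
  apply: le_measure; rewrite ?inE //; first exact: measurableU.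
  move=> w /= vW; have [Mw|Mw] := ltP eps (`| `|M k w - 1%:M| |); first by left.
  (* Off the first event the entries of M are within eps of the identity, where q * eps = a. *)
  right; have M1 i j : `|(M k w - 1%:M) i j| <= eps.
    by apply: le_trans (mx_norm_entry _ i j) _; rewrite -[leLHS]normr_id.
  have qeps1 : 2 * (q%:R * eps) < 1 by rewrite qeps.
  have uW : u < W k w.
    by rewrite ltNge; apply/negP => /(chi2_cdf_le q); rewrite uv leNgt vW.
  have qeps_ge0 : 0 <= q%:R * eps by rewrite qeps ltW.
  have := quad_form_near_id M1 (X k w) qeps_ge0 qeps1.
  rewrite -(WE _ _ (near_id_unitmx M1 qeps1)) qeps => WX.
  have : (1 + a) * t' < (1 + a) * \sum_i X k w i 0 ^+ 2.
    apply: le_lt_trans at' _; apply: lt_le_trans WX.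
    by rewrite ltr_pM2l // subr_gt0.
  by rewrite ltr_pM2l // addr_gt0.
apply: (le_trans (measureU2 _ mE2 mE3)).
apply: (@le_trans _ _ ((eta / 4)%:E + (1 - v' + eta / 4)%:E)%E).
  by apply: leeD => //; exact: ltW.
by rewrite -EFinD lee_fin; lra.
Unshelve. all: by end_near. Qed.

End slutsky.

(** * Asymptotic level of ToMax(L) *)

(* Rows are indexed by k = n / 2, so that row k has n = k.*2 observations. *)
Theorem theorem3 (R : realType) (q : nat) (q_gt0 : (0 < q)%N)
  (L : nat) (L_gt0 : (1 <= L)%N) (alpha : R) (alpha01 : 0 < alpha < 1)
  (disp : nat -> measure_display)
  (Omega : forall k, measurableType (disp k))
  (P : forall k, probability (Omega k) R)
  (d p : nat -> nat)
  (z : forall k, 'I_(k.*2) -> Omega k -> (d k).-tuple R)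
  (theta : forall k, 'I_(p k) -> 'cV[R]_q)
  (Sigma : forall k, 'I_(p k) -> 'M[R]_q)
  (thetahat : forall k, 'I_(p k) -> seq ((d k).-tuple R) -> 'cV[R]_q)
  (Sigmahat : forall k, 'I_(p k) -> seq ((d k).-tuple R) -> 'M[R]_q)
  (Go Gno : forall k, {set 'I_(p k)})
  (jmax : forall k, seq ((d k).-tuple R) -> 'I_(p k))
  (split : forall k, 'I_L -> Omega k -> {set 'I_(k.*2)})
  (z_iid : forall k, iid (P k) (@z k))
  (split_random : forall k, random_splits (P k) (@z k) (@split k))
  (thetahat_meas : forall k j a,
     measurable_statistic (fun D => @thetahat k j D a 0))
  (Sigmahat_meas : forall k j a b,
     measurable_statistic (fun D => @Sigmahat k j D a b))
  (jmax_meas : forall k, measurable_selection (@jmax k))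
  (jmax_max : forall k,
     is_selector (@thetahat k) (@Sigmahat k) (Go k) (@jmax k))
  (Sigma_posdef : forall k j, posdefmx (@Sigma k j))
  (* (a), for the full sample and for half-samples *)
  (hyp_a_full :
     asymptotically_normal P z theta Sigma thetahat Sigmahat (fun k => k.*2))
  (hyp_a_half :
     asymptotically_normal P z theta Sigma thetahat Sigmahat (fun k => k))
  (* (b) *)
  (hyp_b : signal_dominates P z theta thetahat Go)
  (* (c) *)
  (hyp_c : exists2 c : R, 0 < c &
     let u := min_signal double theta Sigma Go Gno in
     cvgn u /\ (c%:E < limn u)%E)
  (H0 : forall k j, j \in Go k -> @theta k j = 0) :
  (limn_esup (fun k => P k [set w |
      tomax_rejects (@thetahat k) (@Sigmahat k) (@jmax k)
        (fun i => @z k i w) (fun l => @split k l w) alpha])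
   <= alpha%:E)%E.
Proof.
have /andP[alpha0 alpha1] := alpha01.
have L0 : 0 < L%:R :> R by rewrite ltr0n.
(* A p-value is below alpha / L exactly when the chi-squared distribution function at the statistic
   exceeds v. *)
pose v := 1 - alpha / L%:R.
have v01 : 0 < v < 1.
  rewrite /v subr_gt0 ltrBlDr ltrDl divr_gt0 // andbT ltr_pdivrMr // mul1r.
  by apply: lt_le_trans alpha1 _; rewrite ler1n.
pose quad k (j : 'I_(p k)) (D : seq ((d k).-tuple R)) : R :=
  k%:R * ((thetahat k j D)^T *m invmx (Sigmahat k j D) *m thetahat k j D) 0 0.
pose b k j D := v < chi2_cdf q (quad k j D).
have mquad k j m : measurable_fun setT
    (fun t : m.-tuple ((d k).-tuple R) => quad k j t).
  apply: measurable_funM => //; apply: measurable_mulmx => i l.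
    apply: measurable_mulmx => {}i {}l.
      rewrite (_ : (fun t => _) = (fun t : m.-tuple _ => thetahat k j t l i)).
        by rewrite (ord1 i); exact: thetahat_meas.
      by apply/funext => t; rewrite mxE.
    by apply: measurable_invmx => {}i {}l; exact: Sigmahat_meas.
  by rewrite (ord1 l); exact: thetahat_meas.
have mb k j m : measurable_fun setT
    (fun t : m.-tuple ((d k).-tuple R) => b k j t).
  apply: measurable_fun_ltr => //.
  exact: (measurableT_comp (measurable_chi2_cdf q) (mquad k j m)).
have halfE k : (k.*2./2 = k)%N by exact: doubleK.
(* [holm_rejectsE] turns rejection into a disjunction over the splits, the form handled by
   [multi_split_le]. *)
have rejE k w : tomax_rejects (@thetahat k) (@Sigmahat k) (@jmax k)
    (fun i => @z k i w) (fun l => @split k l w) alpha =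
    has (fun l => b k (@jmax k (subsample (@z k ^~ w) (@split k l w)))
      (subsample (@z k ^~ w) (~: @split k l w)%SET)) (enum 'I_L).
  rewrite /tomax_rejects /tomax_kmax holm_rejectsE // has_map.
  apply: eq_has => l /=; rewrite size_map size_enum_ord.
  rewrite /tomax_pvalue /tomax_stat halfE /b /v /quad mulrC -ltr_pdivlMr //.
  by rewrite ltrBlDr addrC -ltrBlDr.
(* The reference half-sample is the first k observations, the one that [first_obs] supplies to
   [hyp_a_half]. *)
pose s0 k := [set i : 'I_k.*2 | (i < k)%N]%SET.
have s0k k : #|s0 k| = k.
  have kk : (k <= k.*2)%N by rewrite -addnn leq_addr.
  rewrite /s0 cardsE -sum1_card (eq_bigl (fun i : 'I_k.*2 => (i < k)%N)) //.
  by rewrite (big_ord_narrow kk) sum1_card card_ord.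
have mD k d' (U : measurableType d') (g : seq ((d k).-tuple R) -> U) :
    (forall m, measurable_fun setT (fun t : m.-tuple _ => g t)) ->
    measurable_fun setT (fun w => g (first_obs (fun i => z k i w) k)).
  exact: (measurable_statistic_subsample (z_iid k)).
pose pr k j := P k [set w | b k j (first_obs (fun i => @z k i w) k)].
have Go0 k : @jmax k [::] \in Go k by case: (jmax_max k [::]).
(* Hypothesis (a) controls one sequence of indices at a time; the worst index of each row turns a
   bound along J into a bound over all of [Go k]. The value [jmax k [::]] witnesses that [Go k] is
   nonempty. *)
pose J k := [arg max_(j > @jmax k [::] in Go k) pr k j]%O.
have [JGo Jmax] : (forall k, J k \in Go k) /\
    (forall k j, j \in Go k -> (pr k j <= pr k (J k))%E).
  by split => k; rewrite /J; case: (arg_maxP _ (Go0 k)) => // j.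
have pr_fin k : pr k (J k) \is a fin_num.
  apply: fin_num_measure; apply: measurable_pred_set.
  exact: (mD _ _ _ (b k (J k)) (mb k (J k))).
have row_le k : (P k [set w | tomax_rejects (@thetahat k) (@Sigmahat k)
    (@jmax k) (fun i => @z k i w) (fun l => @split k l w) alpha] <=
    (L%:R * fine (pr k (J k)))%:E)%E.
  under eq_set do rewrite rejE.
  have mbk j m : measurable_fun setT
    (fun t : m.-tuple ((d k).-tuple R) => b k j t) by exact: mb.
  apply: (multi_split_le (z_iid k) (jmax_meas k) mbk (split_random k)
    (s0 := s0 k)).
    by rewrite s0k halfE -addnn addnK.
  move=> D; rewrite fineK //.
  by apply: Jmax; case: (jmax_max k D).
have [cX cM] := hyp_a_half J.
apply: limn_esup_le_near => eta eta0.
(* The tolerance is eta / L because the row bound multiplies by L. *)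
have etaL : 0 < eta / L%:R by rewrite divr_gt0.
pose D k w := first_obs (fun i => @z k i w) k.
pose V k := invsqrtmx (@Sigma k (J k)).
have mX k i : measurable_fun setT (fun w =>
    (V k *m (Num.sqrt k%:R *: (thetahat k (J k) (D k w) - theta k (J k)))) i 0).
  apply: measurable_mulmx => // {}i l.
  rewrite (ord1 l) (_ : (fun w => _) = (fun w => Num.sqrt k%:R *
      (thetahat k (J k) (D k w) i 0 - theta k (J k) i 0))).
    apply: measurable_funM => //; apply: measurable_funB => //.
    exact: (mD k _ _ (fun D => thetahat k (J k) D i 0) (thetahat_meas k (J k) i)).
  by apply/funext => w; rewrite !mxE.
have mM k i l : measurable_fun setT (fun w =>
    (V k *m Sigmahat k (J k) (D k w) *m V k) i l).
  apply: measurable_mulmx => // {}i {}l; apply: measurable_mulmx => // {}i {}l.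
  exact: (mD k _ _ (fun D => Sigmahat k (J k) D i l) (Sigmahat_meas k (J k) i l)).
have mW k : measurable_fun setT (fun w => quad k (J k) (D k w)).
  exact: (mD k _ _ (quad k (J k)) (mquad k (J k))).
have WE k w : V k *m Sigmahat k (J k) (D k w) *m V k \in unitmx ->
    quad k (J k) (D k w) =
    ((V k *m (Num.sqrt k%:R *: (thetahat k (J k) (D k w) - theta k (J k))))^T *m
      invmx (V k *m Sigmahat k (J k) (D k w) *m V k) *m
      (V k *m (Num.sqrt k%:R *: (thetahat k (J k) (D k w) - theta k (J k))))) 0 0.
  move=> Mu; rewrite (quad_form_sandwich _ (invsqrtmx_sym _) Mu).
  (* Under H_0 the centring vanishes, as J k lies in [Go k], and the two factors sqrt k combine into
     k. *)
  rewrite (H0 k _ (JGo k)) subr0 !linearZ /= -!scalemxAl scalerA.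
  by rewrite -expr2 sqr_sqrtr // /quad [RHS]mxE.
have tail := chi2_tail_near q_gt0 v01 mX mM mW WE cX cM etaL.
near=> k; apply: (le_trans (row_le k)); rewrite lee_fin.
(* Both terms of alpha + eta are written as multiples of L, so that L cancels and 1 - v = alpha / L
   remains. *)
rewrite -[X in alpha + X](divfK (lt0r_neq0 L0)).
rewrite -[X in X + _](divfK (lt0r_neq0 L0)).
rewrite -mulrDl mulrC ler_pM2r // -lee_fin fineK; last exact: pr_fin.
apply: (@le_trans _ _ (1 - v + eta / L%:R)%:E); first by near: k.
by rewrite lee_fin /v; lra.
Unshelve. all: by end_near. Qed.
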